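(* (i) If $m\ge 5$ is odd and $n\ge 4$ is even, then $$M(C_m\square C_n)=1+\frac n2\left\lfloor \frac m2\right\rfloor .$$ The transposed statement also holds: if $m\ge 4$ is even and $n\ge 5$ is odd, then $M(C_m\square C_n)=1+\frac m2\lfloor n/2\rfloor$. (ii) The formula $$M(C_m\square C_n)=1+\left\lfloor \frac m2\right\rfloor\left\lfloor \frac n2\right\rfloor$$ holds for $m=7$ and every odd $n\ge 7$, and for $(m,n)\in\{(9,9),(9,11),(9,13)\}$ and the transposed pairs $(11,9),(13,9)$.
   Context: All graphs are finite and simple. $C_m$ is the cycle on $m$ vertices and $\square$ denotes the Cartesian product of graphs. For a graph $G$, a vertex $v$ of $G$ and $S\subseteq V(G)$, put $d_S(v)=|N_G(v)\cap S|$, and let $d_G(v)$ be the degree of $v$ in $G$. A nonempty set $S\subseteq V(G)$ is a majority class if $d_S(v)\ge\lceil d_G(v)/2\rceil$ for every $v\in S$. A majority C-colouring of $G$ is a partition of $V(G)$ into majority classes, and $M(G)$ denotes the largest possible number of parts in such a partition. *)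

(* Defs.v *)
From mathcomp Require Import all_boot.
Set Implicit Arguments.
Unset Strict Implicit.
Unset Printing Implicit Defensive.

Record sgraph := SGraph {
  vertex :> finType;
  adj : rel vertex;
  adj_sym : symmetric adj;
  adj_irrefl : irreflexive adj
}.

Section Cycle.
Variable m : nat.

(* [ordS] is the successor modulo m.  The conjunct [i != j] only matters for
   m = 1, where it removes the loop; for m >= 3 this is the cycle on m
   vertices. *)
Definition cycle_rel : rel 'I_m :=
  fun i j => (i != j) && ((j == ordS i) || (i == ordS j)).

Lemma cycle_rel_sym : symmetric cycle_rel.
Proof. by move=> i j; rewrite /cycle_rel eq_sym orbC. Qed.

Lemma cycle_rel_irrefl : irreflexive cycle_rel.
Proof. by move=> i; rewrite /cycle_rel eqxx. Qed.

Definition cycle_graph : sgraph := SGraph cycle_rel_sym cycle_rel_irrefl.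

End Cycle.

Section CartesianProduct.
Variables G H : sgraph.

Definition cart_rel : rel (G * H) :=
  fun x y =>
  ((x.1 == y.1) && adj x.2 y.2) || ((x.2 == y.2) && adj x.1 y.1).

Lemma cart_rel_sym : symmetric cart_rel.
Proof.
move=> x y; rewrite /cart_rel.
by rewrite (eq_sym x.1) (eq_sym x.2) (adj_sym x.1) (adj_sym x.2).
Qed.

Lemma cart_rel_irrefl : irreflexive cart_rel.
Proof. by move=> x; rewrite /cart_rel !adj_irrefl !andbF. Qed.

Definition cart_prod : sgraph := SGraph cart_rel_sym cart_rel_irrefl.

End CartesianProduct.

Section MajorityColouring.
Variable G : sgraph.

Definition nbhd (v : G) : {set G} := [set u | adj v u].

Definition deg (v : G) : nat := #|nbhd v|.

Definition deg_in (S : {set G}) (v : G) : nat := #|nbhd v :&: S|.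

(* [uphalf d] is the ceiling of d / 2. *)
Definition majority_class (S : {set G}) : bool :=
  (S != set0) && [forall v in S, uphalf (deg v) <= deg_in S v].

Definition majority_colouring (P : {set {set G}}) : bool :=
  partition P [set: G] && [forall S in P, majority_class S].

(* The maximum is over a nonempty family: when G has a vertex, the one-part
   partition [set [set: G]] is a majority colouring. *)
Definition majority_number : nat :=
  \max_(P : {set {set G}} | majority_colouring P) #|P|.

End MajorityColouring.

(* Main.v *)
Require Import Defs.
From mathcomp Require Import all_boot zify.

(* Let m be odd and call {(x, y) : x < m} the row y.  Every vertex of a class S
   has at least two neighbours in S, so a row meeting S in a single cell passes
   that cell on to both adjacent rows.  Hence, unless S contains a full column,
   Q(S) = sum_y floor(|S /\ row y| / 2) is at least 2, while the classes share
   at most floor(m / 2) in each row: there are at most (n / 2) floor(m / 2)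
   classes.  If some class contains a full column, no other class contains a full
   row, and the transposed count on the other m - 1 columns gives
   1 + floor(m / 2) floor(n / 2).

   When n is odd too, the first bound is too weak by a little.  In its equality
   case every Q(S) is 2 and each row is met oddly by exactly one class; a class
   either meets all columns evenly or meets all but two rows in one cell.
   Only one class can be of the second kind, so, n being odd, it meets every
   column, but it meets at most six.  The improved bound suffices for m = 7
   and m = 9. *)

Set Implicit Arguments.
Unset Strict Implicit.
Unset Printing Implicit Defensive.

(** * Cyclic successor and predecessor on ordinals *)

Lemma val_iter_ordS m k (x : 'I_m) : val (iter k (@ordS m) x) = (x + k) %% m.
Proof.
elim: k => [|k IHk] /=; first by rewrite addn0 modn_small.
by rewrite IHk -addn1 modnDml addn1 addnS.
Qed.

Lemma iter_ordS_eq m k l (x : 'I_m) : k < m -> l < m ->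
  (iter k (@ordS m) x == iter l (@ordS m) x) = (k == l).
Proof.
move=> km lm; rewrite -val_eqE /= !val_iter_ordS eqn_modDl.
by rewrite !modn_small.
Qed.

Lemma ordS_neq m (x : 'I_m) : 1 < m -> (ordS x == x) = false.
Proof. by move=> m1; rewrite (@iter_ordS_eq _ 1 0) //; lia. Qed.

Lemma ord_pred_neq m (x : 'I_m) : 1 < m -> (ord_pred x == x) = false.
Proof. by move=> m1; rewrite -{2}[x]ord_predK eq_sym ordS_neq. Qed.

Lemma ordS_pred_neq m (x : 'I_m) : 2 < m -> (ordS x == ord_pred x) = false.
Proof.
move=> m2; rewrite -{1}[x]ord_predK.
by rewrite (@iter_ordS_eq _ 2 0) //; lia.
Qed.

Lemma ordS_closed m (Y : pred 'I_m) (x z : 'I_m) :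
  (forall y, Y y -> Y (ordS y)) -> Y x -> Y z.
Proof.
(* The shift [z + (m - x)] is congruent to z - x modulo [m] and avoids truncated subtraction. *)
move=> YS Yx; have -> : z = iter (z + (m - x)) (@ordS m) x.
  apply: val_inj; rewrite val_iter_ordS; have := ltn_ord x => xm.
  have -> : x + (z + (m - x)) = z + m by lia.
  by rewrite modnDr modn_small.
by elim: (z + _) => //= k; apply: YS.
Qed.

Lemma ord_pred_closed m (Y : pred 'I_m) (x z : 'I_m) :
  (forall y, Y y -> Y (ord_pred y)) -> Y x -> Y z.
Proof.
move=> YP; apply: contraTT => nYz.
apply: (@ordS_closed _ (fun y => ~~ Y y) z x) => // y.
by apply: contra => /YP; rewrite ordSK.
Qed.

(** * Majority classes of the torus as thick sets *)

(** All degrees are 4 when both sides exceed 2, so this is the majority condition, freed from the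
    graph so that it can be transposed and counted. *)
Definition thick m n (S : {set 'I_m * 'I_n}) := forall x y, (x, y) \in S ->
  2 <= ((ordS x, y) \in S) + ((ord_pred x, y) \in S)
       + (((x, ordS y) \in S) + ((x, ord_pred y) \in S)).

Section Neighbours.
Variables m n : nat.
Hypotheses (m2 : 2 < m) (n2 : 2 < n).
Let G := cart_prod (cycle_graph m) (cycle_graph n).

(** The weight [F] is 1 for the degree and the indicator of a class for [deg_in]. Sides above 2 keep
    the four neighbours distinct. *)
Lemma sum_nbhd (F : 'I_m * 'I_n -> nat) (x : 'I_m) (y : 'I_n) :
  \sum_(u in nbhd ((x, y) : G)) F u
    = F (ordS x, y) + F (ord_pred x, y) + (F (x, ordS y) + F (x, ord_pred y)).
Proof.
have cycE k (i j : 'I_k) : 2 < k ->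
    cycle_rel i j = (j == ordS i) || (j == ord_pred i).
  move=> k2; rewrite /cycle_rel.
  have -> : (i == ordS j) = (j == ord_pred i).
    by apply/eqP/eqP => [->|->]; rewrite ?ordSK ?ord_predK.
  case: eqVneq => //= <-.
  by rewrite ![i == _]eq_sym ordS_neq ?ord_pred_neq //; lia.
have -> : nbhd ((x, y) : G) =
    [set (ordS x, y); (ord_pred x, y); (x, ordS y); (x, ord_pred y)].
  apply/setP=> -[u v]; rewrite !inE -!pair_eqE /=.
  rewrite /adj /= /cart_rel /= /adj /= !cycE // [x == u]eq_sym [y == v]eq_sym.
  by case: (u == x); case: (v == y); case: (u == _); case: (v == _);
     case: (u == _); case: (v == _).
rewrite -!setUA !big_setU1 ?big_set1 ?inE -?pair_eqE /=;
  rewrite ?[x == _]eq_sym ?[y == _]eq_sym ?ordS_neq ?ord_pred_neq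
    ?ordS_pred_neq ?andbF //=; try lia.
Qed.

Lemma majority_classP (S : {set 'I_m * 'I_n}) :
  majority_class (S : {set G}) <-> S != set0 /\ thick S.
Proof.
have degE x y : deg ((x, y) : G) = 4 by rewrite /deg -sum1_card sum_nbhd.
have deg_inE x y : deg_in (S : {set G}) ((x, y) : G) =
    ((ordS x, y) \in S) + ((ord_pred x, y) \in S)
       + (((x, ordS y) \in S) + ((x, ord_pred y) \in S)).
  rewrite /deg_in -sum1_card.
  rewrite (eq_bigl (fun u => (u \in nbhd ((x, y) : G)) && (u \in S))); last first.
    by move=> u; rewrite inE.
  by rewrite big_mkcondr /= (sum_nbhd (fun u => if u \in S then 1 else 0));
     do 4!case: (_ \in S).
split=> [/andP[S0 /forallP Sthick]|[S0 Sthick]].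
  split=> // x y xyS; have /implyP/(_ xyS) := Sthick (x, y).
  by rewrite degE deg_inE.
apply/andP; split=> //; apply/forallP=> -[x y]; apply/implyP=> xyS.
by rewrite degE deg_inE; apply: Sthick.
Qed.

End Neighbours.

(** * Transposition and row counts *)

Definition transp m n (S : {set 'I_m * 'I_n}) : {set 'I_n * 'I_m} :=
  [set p | (p.2, p.1) \in S].

Lemma in_transp m n (S : {set 'I_m * 'I_n}) x y :
  ((x, y) \in transp S) = ((y, x) \in S).
Proof. by rewrite inE. Qed.

Lemma transpK m n : cancel (@transp m n) (@transp n m).
Proof. by move=> S; apply/setP=> -[x y]; rewrite !in_transp. Qed.

Lemma thick_transp m n (S : {set 'I_m * 'I_n}) : thick S -> thick (transp S).
Proof. by move=> + x y; rewrite !in_transp addnC; apply. Qed.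

Definition row_card m n (S : {set 'I_m * 'I_n}) (y : 'I_n) :=
  #|[pred x | (x, y) \in S]|.

Lemma row_card_ge m n (S : {set 'I_m * 'I_n}) y s :
  uniq s -> all (fun x => (x, y) \in S) s -> size s <= row_card S y.
Proof.
move=> /card_uniqP <- /allP sS; apply: subset_leq_card.
by apply/subsetP=> x /sS; rewrite inE.
Qed.

Definition full_column m n (S : {set 'I_m * 'I_n}) :=
  exists x, forall y, (x, y) \in S.

Definition full_row m n (S : {set 'I_m * 'I_n}) :=
  exists y, forall x, (x, y) \in S.

(** * Half-row sums of a thick set *)

Section Thick.
Variables (m n : nat) (S : {set 'I_m * 'I_n}).
Hypotheses (m3 : 3 < m) (n2 : 2 < n) (S0 : S != set0) (Sthick : thick S).

Lemma lone_vertical x y : row_card S y <= 1 -> (x, y) \in S ->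
  ((x, ordS y) \in S) && ((x, ord_pred y) \in S).
Proof.
move=> Sy xyS; have lone x' : (x' == x) = false -> ((x', y) \in S) = false.
  move=> x'x; apply: contraTF Sy => x'yS; rewrite -ltnNge.
  by apply: (@row_card_ge _ _ _ _ [:: x'; x]); rewrite /= ?inE ?x'x ?x'yS ?xyS.
move: (Sthick xyS); rewrite !lone ?ordS_neq ?ord_pred_neq ?(ltnW (ltnW m3)) //.
by case: (_ \in S); case: (_ \in S).
Qed.

(** A cell off row [i] passes itself on to both adjacent rows, so it fills its column. With no cell
    off row [i], horizontal neighbours carry membership all around row [i]. *)
Lemma one_wide_row i : (forall y, y != i -> row_card S y <= 1) ->
  full_column S \/ full_row S.
Proof.
move=> Si; have [/existsP[[x y] /= /andP[xyS yi]]|] :=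
    boolP [exists p in S, p.2 != i].
  left; exists x => z; pose Y t := (x, t) \in S.
  have YSP t : Y t -> t != i -> Y (ordS t) && Y (ord_pred t).
    by move=> Yt /Si St; apply: lone_vertical.
  (* Otherwise the rows other than [i] where column [x] meets [S] would be closed under [ordS] and
     so include [i]. *)
  have YS : Y (ord_pred i).
    apply: contraT => nY; have /andP[_ /negbTE] : Y i && (i != i).
      apply: (@ordS_closed _ (fun t => Y t && (t != i)) y) => [t|];
        last by rewrite [Y y]xyS yi.
      move=> /andP[Yt ti]; have /andP[-> _] /= := YSP _ Yt ti.
      by apply: contraNneq nY => <-; rewrite ordSK.
    by rewrite eqxx.
  have YP : Y (ordS i).
    apply: contraT => nY; have /andP[_ /negbTE] : Y i && (i != i).
      apply: (@ord_pred_closed _ (fun t => Y t && (t != i)) y) => [t|];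
        last by rewrite [Y y]xyS yi.
      move=> /andP[Yt ti]; have /andP[_ ->] /= := YSP _ Yt ti.
      by apply: contraNneq nY => <-; rewrite ord_predK.
    by rewrite eqxx.
  apply: (@ordS_closed _ Y y) => // t Yt.
  by have [->|/(YSP _ Yt)/andP[]] := eqVneq t i.
move/existsPn => Sonly; right; exists i => z.
have Srow x y : (x, y) \in S -> y = i.
  by move=> xyS; apply/eqP; move: (Sonly (x, y)); rewrite xyS /= negbK.
have /set0Pn[[x y] xyS] := S0; have yi := Srow _ _ xyS; rewrite yi in xyS.
apply: (@ordS_closed _ (fun x => (x, i) \in S) x) => // t tiS.
have out j : (j == i) = false -> ((t, j) \in S) = false.
  by move=> ji; apply: contraFF ji => /Srow/eqP.
move: (Sthick tiS); rewrite !out ?ordS_neq ?ord_pred_neq //; try lia.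
by case: ((_, _) \in S); case: ((_, _) \in S).
Qed.

(** With a sum below 2, at most one row holds two cells, so [one_wide_row] applies; a full row alone
    contributes [m./2], which is at least 2. *)
Lemma two_half_rows : ~ full_column S -> 2 <= \sum_y (row_card S y)./2.
Proof.
move=> nfull; rewrite leqNgt; apply/negP => Q2.
have [p pS] := set0Pn _ S0.
have [i Si] : exists i, forall y, y != i -> row_card S y <= 1.
  have [/existsP[i Si]|/existsPn S1] := boolP [exists y, 1 < row_card S y].
    exists i => y yi; rewrite leqNgt; apply/negP => Sy.
    by move: Q2; rewrite (bigD1 i) //= (bigD1 y) //=; lia.
  by exists p.2 => y _; rewrite leqNgt.
have [//|[y Sy]] := one_wide_row Si.
have : m <= row_card S y.
  rewrite -{1}[m]size_enum_ord; apply: row_card_ge; first exact: enum_uniq.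
  by apply/allP => x _; apply: Sy.
by move: Q2; rewrite (bigD1 y) //=; lia.
Qed.

End Thick.

(** * Upper bounds by double counting *)

(** One counting identity encodes disjointness and covering, ready for exchanging sums. *)
Definition torus_partition m n (P : {set {set 'I_m * 'I_n}}) :=
  (forall p, \sum_(S in P) (p \in S) = 1)
  /\ (forall S, S \in P -> S != set0 /\ thick S).

Lemma majority_colouring_torus m n (P : {set {set 'I_m * 'I_n}}) :
  2 < m -> 2 < n ->
  majority_colouring (P : {set {set cart_prod (cycle_graph m) (cycle_graph n)}}) ->
  torus_partition P.
Proof.
move=> m2 n2 /andP[/and3P[/eqP covP tiP _] /forallP Pmaj]; split=> [p|S SP].
  have Pp : p \in cover P by rewrite [cover P]covP inE.
  rewrite (bigD1 (pblock P p)) ?pblock_mem //= mem_pblock Pp big1 // => S.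
  by case/andP=> SP; case: (boolP (p \in S)) => // pS /eqP[]; rewrite (def_pblock tiP SP pS).
by have /implyP/(_ SP) := Pmaj S; rewrite majority_classP.
Qed.

Lemma transp_inj m n : injective (@transp m n).
Proof. exact: can_inj (@transpK m n). Qed.

Lemma torus_partition_transp m n (P : {set {set 'I_m * 'I_n}}) :
  torus_partition P -> torus_partition (@transp m n @: P).
Proof.
move=> [P1 Pthick]; split=> [[x y]|_ /imsetP[S SP ->]].
  rewrite big_imset /=; last by move=> S T _ _; apply: transp_inj.
  by rewrite -(P1 (y, x)); apply: eq_bigr => S _; rewrite in_transp.
have [/set0Pn[[x y] xyS] Sthick] := Pthick S SP.
split; last exact: thick_transp.
by apply/set0Pn; exists (y, x); rewrite in_transp.
Qed.

Lemma sum_row_card m n (P : {set {set 'I_m * 'I_n}}) y :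
  torus_partition P -> \sum_(S in P) row_card S y = m.
Proof.
move=> [P1 _]; under eq_bigr do rewrite /row_card -sum1_card big_mkcond /=.
rewrite exchange_big /= -[RHS]card_ord -sum1_card; apply: eq_bigr => x _.
by rewrite -(P1 (x, y)); apply: eq_bigr => S _; rewrite inE; case: ifP.
Qed.

Lemma sum_half_row m n (P : {set {set 'I_m * 'I_n}}) y : torus_partition P ->
  \sum_(S in P) odd (row_card S y) + (\sum_(S in P) (row_card S y)./2).*2 = m.
Proof.
move=> Ppart; rewrite -[RHS](sum_row_card y Ppart) -mul2n big_distrr -big_split /=.
by apply: eq_bigr => S _; rewrite mul2n odd_double_half.
Qed.

Lemma sum_half_row_le m n (P : {set {set 'I_m * 'I_n}}) y :
  torus_partition P -> \sum_(S in P) (row_card S y)./2 <= m./2.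
Proof. by move=> /(sum_half_row y); lia. Qed.

Lemma no_full_column_bound m n (P : {set {set 'I_m * 'I_n}}) :
  3 < m -> 2 < n -> torus_partition P ->
  (forall S, S \in P -> ~ full_column S) -> #|P|.*2 <= n * m./2.
Proof.
move=> m3 n2 Ppart ncol; have [_ Pthick] := Ppart.
rewrite -muln2 -sum_nat_const -[X in _ <= X * _]card_ord -sum_nat_const.
apply: (@leq_trans (\sum_(S in P) \sum_y (row_card S y)./2)).
  by apply: leq_sum => S SP; have [] := Pthick S SP => *; apply: two_half_rows; auto.
by rewrite exchange_big; apply: leq_sum => y _; apply: sum_half_row_le.
Qed.

(* The other classes avoid the column, so none of them contains a full row and
   the transposed count applies to the remaining [m.-1] columns. *)
Lemma full_column_bound m n (P : {set {set 'I_m * 'I_n}}) S0 :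
  2 < m -> 3 < n -> torus_partition P -> S0 \in P -> full_column S0 ->
  #|P|.-1.*2 <= m.-1 * n./2.
Proof.
move=> m2 n3 Ppart S0P [x0 S0x0]; have [P1 Pthick] := Ppart.
have avoid S y : S \in P -> S != S0 -> ((x0, y) \in S) = false.
  move=> SP SS0; apply/negbTE/negP=> xyS; move: (P1 (x0, y)).
  by rewrite (bigD1 S0) //= (bigD1 S) ?SP //= S0x0 xyS.
have -> : #|P|.-1 = #|P :\ S0| by rewrite (cardsD1 S0 P) S0P.
have -> : m.-1 = #|[pred x | x != x0]| by rewrite cardC1 card_ord.
rewrite -muln2 -!sum_nat_const.
apply: (@leq_trans (\sum_(S in P :\ S0) \sum_(x | x != x0)
                     (row_card (transp S) x)./2)).
  apply: leq_sum => S /setD1P[SS0 SP]; have [Sn0 Sthick] := Pthick S SP.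
  (* [S0] occupies column [x0], so the term of that column vanishes for every other class. *)
  have -> : \sum_(x | x != x0) (row_card (transp S) x)./2 =
            \sum_x (row_card (transp S) x)./2.
    rewrite [RHS](bigD1 x0) //= [row_card _ x0]eq_card0 // => y.
    by rewrite inE in_transp avoid.
  apply: two_half_rows => //; last 1 first.
  - by case=> y /(_ x0); rewrite in_transp avoid.
  - have /set0Pn[[x y] xyS] := Sn0.
    by apply/set0Pn; exists (y, x); rewrite in_transp.
  exact: thick_transp.
rewrite exchange_big; apply: leq_sum => x _.
have := sum_half_row_le x (torus_partition_transp Ppart).
rewrite big_imset /=; last by move=> S T _ _; apply: transp_inj.
by rewrite [X in X <= _](big_setD1 S0) //=; lia.
Qed.

(** * Lower bounds by block colourings *)

(** The fibres of [c] are the parts; surjectivity makes them nonempty and pairwise distinct. *)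
Lemma majority_number_ge_colours m n (T : finType) (c : 'I_m * 'I_n -> T) :
  2 < m -> 2 < n -> (forall t, exists p, c p = t) ->
  (forall x y, 2 <= (c (ordS x, y) == c (x, y)) + (c (ord_pred x, y) == c (x, y))
              + ((c (x, ordS y) == c (x, y)) + (c (x, ord_pred y) == c (x, y)))) ->
  #|T| <= majority_number (cart_prod (cycle_graph m) (cycle_graph n)).
Proof.
move=> m2 n2 csurj cthick.
pose F t : {set cart_prod (cycle_graph m) (cycle_graph n)} := [set p | c p == t].
have F0 t : F t != set0.
  by have [p cp] := csurj t; apply/set0Pn; exists p; rewrite inE cp.
have Finj : injective F.
  move=> s t Fst; have [p cp] := csurj s.
  have : p \in F s by rewrite inE cp.
  by rewrite Fst inE cp => /eqP.
rewrite -cardsT -(card_imset _ Finj).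
apply: (@leq_bigmax_cond _ (@majority_colouring _) (fun P => #|P|) (F @: setT)).
apply/andP; split.
  apply/and3P; split.
  - apply/eqP/setP=> p; rewrite inE; apply/bigcupP; exists (F (c p)).
      exact: imset_f.
    by rewrite inE.
  - apply/trivIsetP => _ _ /imsetP[s _ ->] /imsetP[t _ ->] Fst.
    apply/pred0P => p; rewrite /= !inE; apply/negbTE; apply: contraNN Fst.
    by case/andP=> /eqP-> /eqP->.
  by apply/imsetP => -[t _ /esym/eqP]; apply/negP.
apply/forallP => S; apply/implyP => /imsetP[t _ ->].
apply/majority_classP => //; split=> // x y; rewrite !inE => /eqP <-.
exact: cthick.
Qed.

(* Colour [Some] by 2 x 2 blocks; [None] is the remaining column, together with
   the remaining row when [n] is odd. *)
Section Blocks.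
Variables m n : nat.
Hypotheses (modd : odd m) (m2 : 2 < m) (n2 : 2 < n).

Definition block_colour (p : 'I_m * 'I_n) : option ('I_(m./2) * 'I_(n./2)) :=
  if insub (p.1 : nat)./2 is Some i then
    if insub (p.2 : nat)./2 is Some j then Some (i, j) else None
  else None.

Lemma block_colour_eq p q : (block_colour p == block_colour q) =
  if ((p.1 : nat)./2 < m./2) && ((p.2 : nat)./2 < n./2)
  then ((p.1 : nat)./2 == (q.1 : nat)./2) && ((p.2 : nat)./2 == (q.2 : nat)./2)
  else ~~ (((q.1 : nat)./2 < m./2) && ((q.2 : nat)./2 < n./2)).
Proof.
rewrite /block_colour.
case: insubP => [i -> <-|/negbTE ->] /=; last first.
  by case: insubP => [i' -> _|/negbTE ->] //=; case: insubP => [j' -> _|/negbTE ->].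
case: insubP => [j -> <-|/negbTE ->] /=; last first.
  by case: insubP => [i' -> _|/negbTE ->] //=; case: insubP => [j' -> _|/negbTE ->].
case: insubP => [i' _ <-|qi] /=; last first.
  by apply/esym/andP => -[/eqP ii' _]; rewrite -ii' ltn_ord in qi.
case: insubP => [j' _ <-|qj] /=; last first.
  by apply/esym/andP => -[_ /eqP jj']; rewrite -jj' ltn_ord in qj.
by rewrite /eq_op /= /eq_op.
Qed.

Lemma val_ordS k (i : 'I_k) : val (ordS i) = if i.+1 == k then 0 else i.+1.
Proof.
have := ltn_ord i; rewrite /=; case: eqP => [->|*]; first by rewrite modnn.
by rewrite modn_small //; lia.
Qed.

Lemma val_ord_pred k (i : 'I_k) : val (ord_pred i) = if i == 0 :> nat then k.-1 else i.-1.
Proof.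
have := ltn_ord i; rewrite /=; case: eqP => [->|? ?].
  by move=> ?; rewrite modn_small //; lia.
have -> : (i + k).-1 = i.-1 + k by lia.
by rewrite modnDr modn_small //; lia.
Qed.

Lemma block_colour_thick x y :
  2 <= (block_colour (ordS x, y) == block_colour (x, y))
       + (block_colour (ord_pred x, y) == block_colour (x, y))
       + ((block_colour (x, ordS y) == block_colour (x, y))
          + (block_colour (x, ord_pred y) == block_colour (x, y))).
Proof.
rewrite ![_ == block_colour (x, y)]eq_sym !block_colour_eq /=.
have := val_ordS x; have := val_ordS y; have := val_ord_pred x; have := val_ord_pred y.
rewrite /= => -> -> -> ->.
move: (ltn_ord x) (ltn_ord y); move: (nat_of_ord x) (nat_of_ord y) => i j im jn.
have [/andP[ia jb]|/nandP] := boolP ((i./2 < m./2) && (j./2 < n./2)).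
  (* Inside a block, the other element of the pair {2a, 2a+1} gives a horizontal neighbour; [hy] is
     the vertical analogue. *)
  have hx : 1 <= (i./2 == (if i.+1 == m then 0 else i.+1)./2)
               + (i./2 == (if i == 0 then m.-1 else i.-1)./2).
    by case: (boolP (odd i)) => ?; case: ifP; case: ifP; lia.
  have hy : 1 <= (j./2 == (if j.+1 == n then 0 else j.+1)./2)
               + (j./2 == (if j == 0 then n.-1 else j.-1)./2).
    by case: (boolP (odd j)) => ?; case: ifP; case: ifP; lia.
  by rewrite !eqxx andbT andbT /=; lia.
(* A cell of the leftover column has both vertical neighbours in that column; likewise for the
   leftover row, horizontally. *)
rewrite -!leqNgt => -[ia|jb].
  by rewrite [i./2 < _]ltnNge ia /= addn2.
by rewrite [j./2 < _]ltnNge jb !andbF /=.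
Qed.

Lemma block_colour_surj t : exists p, block_colour p = t.
Proof.
case: t => [[i j]|].
  have im : i.*2 < m by have := ltn_ord i; lia.
  have jn : j.*2 < n by have := ltn_ord j; lia.
  exists (Ordinal im, Ordinal jn); rewrite /block_colour /= !doubleK !valK.
  by [].
(* As [m] is odd, [m.-1] halves to [m./2], which is out of range and yields [None]. *)
have im : m.-1 < m by lia.
have jn : 0 < n by lia.
exists (Ordinal im, Ordinal jn); rewrite /block_colour insubF //=; lia.
Qed.

Lemma block_colours_bound : 1 + m./2 * n./2 <=
  majority_number (cart_prod (cycle_graph m) (cycle_graph n)) /\
  1 + m./2 * n./2 <= majority_number (cart_prod (cycle_graph n) (cycle_graph m)).
Proof.
have <- : #|{: option ('I_(m./2) * 'I_(n./2))}| = 1 + m./2 * n./2.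
  by rewrite card_option card_prod !card_ord.
split.
  apply: (majority_number_ge_colours m2 n2 block_colour_surj).
  exact: block_colour_thick.
apply: (majority_number_ge_colours n2 m2 (c := fun p => block_colour (p.2, p.1))).
  by move=> t; have [[x y] <-] := block_colour_surj t; exists (y, x).
by move=> x y; rewrite addnC; apply: block_colour_thick.
Qed.

End Blocks.

(** * Classes whose half-row sum is two *)

Section TwoHalves.
Variables (m n : nat) (S : {set 'I_m * 'I_n}).
Hypotheses (m6 : 6 < m) (n2 : 2 < n) (S0 : S != set0) (Sthick : thick S).
Hypotheses (nfull_col : ~ full_column S) (nfull_row : ~ full_row S).
Hypothesis two_halves : \sum_y (row_card S y)./2 = 2.

Let m3 : 3 < m := ltnW (ltnW (ltnW m6)).

Definition wide_rows i i' := [/\ i != i', 2 <= row_card S i <= 3,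
  2 <= row_card S i' <= 3 & forall y, y != i -> y != i' -> row_card S y <= 1].

Lemma wide_rowsC i i' : wide_rows i i' -> wide_rows i' i.
Proof. by case=> ii' Si Si' Sy; split=> //; rewrite 1?eq_sym //; auto. Qed.

(** If one row carried the whole sum, [one_wide_row] would give a full line. *)
Lemma exists_wide_rows : exists i i', wide_rows i i'.
Proof.
have [i Si] : exists i, 1 < row_card S i.
  apply/existsP; apply: contra_eqT two_halves => /existsPn S1.
  by rewrite big1 // => y _; have := S1 y; lia.
have [/existsP[i' /andP[i'i Si']]|/existsPn Sy] :=
    boolP [exists i', (i' != i) && (1 < row_card S i')]; last first.
  have Si1 y : y != i -> row_card S y <= 1.
    by move=> yi; have := Sy y; rewrite yi /= -leqNgt.
  by case: (one_wide_row m3 n2 S0 Sthick Si1).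
exists i, i'; move: two_halves; rewrite (bigD1 i) //= (bigD1 i') //= => Q2.
split; [by rewrite eq_sym | lia | lia |] => y yi yi'.
by move: Q2; rewrite (bigD1 y) /= ?yi //; lia.
Qed.

Lemma row_shift y x ks : uniq ks -> all (fun k => k < m) ks ->
  all (fun k => (iter k (@ordS m) x, y) \in S) ks -> size ks <= row_card S y.
Proof.
move=> uks ksm ksS; rewrite -(size_map (fun k => iter k (@ordS m) x)).
apply: row_card_ge; last by rewrite all_map.
rewrite map_inj_in_uniq // => k l /(allP ksm) km /(allP ksm) lm /eqP.
by rewrite iter_ordS_eq // => /eqP.
Qed.

(* A cell without vertical neighbours is the middle of the three cells of its row. *)
Lemma narrow_middle x y : row_card S y <= 3 -> (x, y) \in S ->
  (x, ordS y) \notin S -> (x, ord_pred y) \notin S ->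
  forall u, u \in [:: ordS x; ord_pred x] ->
    (u, y) \in S /\ ((u, ordS y) \in S) || ((u, ord_pred y) \in S).
Proof.
move=> Sy xyS /negbTE nS /negbTE nP.
have /andP[xS xP] : ((ordS x, y) \in S) && ((ord_pred x, y) \in S).
  by have := Sthick xyS; rewrite nS nP; case: (_ \in S); case: (_ \in S).
(* A fourth consecutive cell would exceed the three allowed, so each end cell still lacks a
   neighbour, which must be vertical. *)
have nSS : ((ordS (ordS x), y) \in S) = false.
  apply: contraTF Sy => SS; rewrite -ltnNge.
  apply: (@row_shift y (ord_pred x) [:: 0; 1; 2; 3]) => //=; first by lia.
  by rewrite ord_predK xP xyS xS SS.
have nPP : ((ord_pred (ord_pred x), y) \in S) = false.
  apply: contraTF Sy => PP; rewrite -ltnNge.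
  apply: (@row_shift y (ord_pred (ord_pred x)) [:: 0; 1; 2; 3]) => //=; first by lia.
  by rewrite !ord_predK PP xP xyS xS.
move=> u; rewrite !inE => /orP[]/eqP->; split=> //.
  have := Sthick xS; rewrite nSS ordSK xyS.
  by case: (_ \in S) => //; case: (_ \in S).
have := Sthick xP; rewrite nPP ord_predK xyS.
by case: (_ \in S) => //; case: (_ \in S).
Qed.

(** Either all cells of row [i] have a neighbour in row [ord_pred i], or one without it is a middle
    cell and both its horizontal neighbours have one. So row [ord_pred i] has two cells and is
    wide. *)
Lemma wide_rows_top i i' : wide_rows i i' ->
  row_card S (ordS i) = 0 -> ord_pred i = i'.
Proof.
move=> [ii' /andP[Si2 Si3] _ Sy] Si1; apply/eqP; apply: contraT => pi'.
have Sp1 : row_card S (ord_pred i) <= 1.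
  by rewrite Sy // ord_pred_neq //; lia.
have nS x : (x, ordS i) \notin S.
  by have := card0_eq Si1 x; rewrite inE => ->.
suff : 1 < row_card S (ord_pred i) by lia.
have [/forallP Spred|] := boolP [forall x, ((x, i) \in S) ==> ((x, ord_pred i) \in S)].
  apply: leq_trans Si2 _; apply: subset_leq_card; apply/subsetP => x.
  by rewrite !inE; apply/implyP.
case/forallPn => x; rewrite negb_imply => /andP[xS nP].
have mid := narrow_middle Si3 xS (nS x) nP.
have := mid (ordS x); have := mid (ord_pred x).
rewrite !inE !eqxx orbT (negbTE (nS _)) (negbTE (nS _)) /=.
move=> /(_ isT)[_ PS] /(_ isT)[_ SS].
by apply: (@row_shift _ (ord_pred x) [:: 0; 2]); rewrite //= ?ord_predK ?PS ?SS //; lia.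
Qed.

(** If some row is empty, some nonempty row [k] is followed by an empty one; [k] must be wide, and
    by [wide_rows_top] the other wide row [k'] comes just before it. Going backward from [j], rows
    stay nonempty and never reach [k] or [k'], since [k] is entered only from the empty [ordS k],
    and [k'] only from [k]. *)
Lemma wide_rows_all i i' x j : wide_rows i i' -> (x, j) \in S ->
  j != i -> j != i' -> forall y, 0 < row_card S y.
Proof.
move=> wide xjS ji ji' z; rewrite lt0n; apply: contraT; rewrite negbK => Sz.
pose H y := row_card S y != 0.
have Hj : H j by rewrite /H -lt0n; apply/card_gt0P; exists x; rewrite inE.
have step k k' y : wide_rows k k' -> H y -> y != k -> y != k' ->
    H (ordS y) && H (ord_pred y).
  move=> [_ _ _ Sy]; rewrite /H -lt0n => /card_gt0P[t]; rewrite inE => tyS yk yk'.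
  have /andP[tS tP] : ((t, ordS y) \in S) && ((t, ord_pred y) \in S).
    exact: (lone_vertical m3 Sthick (Sy _ yk yk') tyS).
  by rewrite -!lt0n; apply/andP; split; apply/card_gt0P; exists t; rewrite inE.
have [k [k' [wk jk jk' Hk]]] : exists k k',
    [/\ wide_rows k k', j != k, j != k' & row_card S (ordS k) = 0].
  have [/existsP[y /andP[Hy nHy]]|] := boolP [exists y, H y && ~~ H (ordS y)].
    rewrite negbK in nHy; move/eqP: nHy => nHy.
    have [yi|yi] := eqVneq y i; first by exists i, i'; split; rewrite // -yi.
    have [yi'|yi'] := eqVneq y i'.
      by exists i', i; split=> //; [apply: wide_rowsC | rewrite -yi'].
    by have /andP[] := step _ _ _ wide Hy yi yi'; rewrite /H nHy.
  move/existsPn => HS; have : H z; last by rewrite /H Sz.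
  by apply: (@ordS_closed _ H j) => // y Hy; have := HS y; rewrite Hy negbK.
have pk := wide_rows_top wk Hk.
have /and3P[] : [&& H z, z != k & z != k']; last by rewrite /H Sz.
apply: (@ord_pred_closed _ (fun y => [&& H y, y != k & y != k']) j).
  move=> y /and3P[Hy yk yk']; have /andP[_ HP] := step _ _ _ wk Hy yk yk'.
  rewrite HP /=; apply/andP; split.
    by apply: contraTneq Hy => pyk; rewrite -[y]ord_predK pyk /H Hk.
  by rewrite -pk; apply: contraNneq yk => /ord_pred_inj ->.
by rewrite Hj jk jk'.
Qed.

(** Otherwise [(x, i)] is the middle of its row, and its two horizontal neighbours have vertical
    ones in row [i']. Each of the latter needs a horizontal neighbour other than [(x, i')], which
    makes four cells in row [i']. *)
Lemma wide_rows_mirror i i' : wide_rows i i' ->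
  (forall x y, (x, y) \in S -> y = i \/ y = i') ->
  forall x, (x, i) \in S -> (x, i') \in S.
Proof.
move=> [ii' /andP[_ Si3] /andP[_ Si3'] _] Sonly x xS; apply: contraT => nx.
have vert u : ((u, ordS i) \in S) || ((u, ord_pred i) \in S) ->
    (u, i') \in S.
  case/orP=> uS; have [E|<- //] := Sonly _ _ uS.
    by have := @ordS_neq _ i (ltnW n2); rewrite E eqxx.
  by have := @ord_pred_neq _ i (ltnW n2); rewrite E eqxx.
have mid : forall u, u \in [:: ordS x; ord_pred x] ->
    (u, i) \in S /\ (u, i') \in S.
  move=> u ux; have [||uS /vert uS'] := narrow_middle Si3 xS _ _ ux => //.
    by apply: contra nx => nS; apply: vert; rewrite nS.
  by apply: contra nx => nP; apply: vert; rewrite nP orbT.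
have outer u : (u, i') \in S ->
    1 <= ((ordS u, i') \in S) + ((ord_pred u, i') \in S).
  move=> uS; have : ~~ (((u, ordS i') \in S) && ((u, ord_pred i') \in S)).
    apply/negP => /andP[aS bS].
    have [a|/eqP] := Sonly _ _ aS; last by rewrite ordS_neq //; lia.
    have [b|/eqP] := Sonly _ _ bS; last by rewrite ord_pred_neq //; lia.
    by have := @ordS_pred_neq _ i' n2; rewrite a b eqxx.
  by have := Sthick uS; do 4!case: (_ \in S).
have [_ xS'] := mid (ordS x) (mem_head _ _).
have [_ xP'] := mid (ord_pred x) (mem_last (ordS x) [:: ord_pred x]).
have := outer _ xS'; have := outer _ xP'.
rewrite ordSK ord_predK (negbTE nx) addn0 add0n !lt0b => PP SS.
suff : 3 < row_card S i' by lia.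
(* Counted from two places before [x], the missing offset 2 is [x] itself. *)
apply: (@row_shift _ (ord_pred (ord_pred x)) [:: 0; 1; 3; 4]) => //=; first by lia.
by rewrite !ord_predK PP xP' xS' SS.
Qed.

(** If all cells lie in the wide rows, mirroring both ways leaves zero or two cells in each
    column. *)
Lemma spread_or_even_columns :
  (exists i i', wide_rows i i' /\ forall y, 0 < row_card S y)
  \/ forall x, ~~ odd (row_card (transp S) x).
Proof.
have [i [i' wide]] := exists_wide_rows.
have [/existsP[[x j] /and3P[xjS ji ji']]|/existsPn Sonly] :=
    boolP [exists p, [&& p \in S, p.2 != i & p.2 != i']].
  by left; exists i, i'; split=> //; apply: wide_rows_all wide xjS ji ji'.
right=> x; have {}Sonly u y : (u, y) \in S -> y = i \/ y = i'.
  move=> uyS; have := Sonly (u, y); rewrite uyS /= negb_and !negbK.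
  by case/orP=> /eqP; [left | right].
have mir : (x, i) \in S -> (x, i') \in S by apply: wide_rows_mirror Sonly _.
have mir' : (x, i') \in S -> (x, i) \in S.
  apply: (wide_rows_mirror (wide_rowsC wide)) => u y /Sonly[]; by [right | left].
have -> : row_card (transp S) x = if (x, i) \in S then 2 else 0.
  case: ifP => xS; last first.
    apply: eq_card0 => y; rewrite inE in_transp; apply: contraFF xS => xyS.
    by have [yi|yi] := Sonly _ _ xyS; rewrite yi in xyS; auto.
  have [ii' _ _ _] := wide; have := cards2 i i'; rewrite ii' => <-.
  apply: eq_card => y; rewrite !inE; apply/idP/orP => /= [|[]/eqP->] //; auto.
  by case/Sonly=> ->; auto.
by case: ifP.
Qed.

(** Outside the wide rows every cell is alone in its row, so a column avoiding them would be filled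
    by vertical spreading. *)
Lemma column_meets_wide_row i i' x : wide_rows i i' ->
  0 < row_card (transp S) x -> ((x, i) \in S) || ((x, i') \in S).
Proof.
move=> [_ _ _ Sy] /card_gt0P[y]; rewrite inE in_transp => xyS.
apply: contra_notT nfull_col; rewrite negb_or => /andP[ni ni'].
exists x => z; apply: (@ordS_closed _ (fun z => (x, z) \in S) y) => // t tS.
have /andP[//] : ((x, ordS t) \in S) && ((x, ord_pred t) \in S).
apply: (lone_vertical m3 Sthick _ tS); apply: Sy.
  by apply: contraNneq ni => <-.
by apply: contraNneq ni' => <-.
Qed.

End TwoHalves.

(** * The sharpened bound for two odd sides *)

Lemma wide_rows_odd m n (S : {set 'I_m * 'I_n}) i i' y : wide_rows S i i' ->
  0 < row_card S y -> y != i -> y != i' -> odd (row_card S y).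
Proof. by case=> _ _ _ Sy + yi yi'; have := Sy y yi yi'; case: row_card => [|[]]. Qed.

Lemma no_full_line_bound m n (P : {set {set 'I_m * 'I_n}}) :
  6 < m -> odd m -> 4 < n -> odd n -> torus_partition P ->
  (forall S, S \in P -> ~ full_column S) ->
  (forall S, S \in P -> ~ full_row S) -> #|P|.*2 < n * m./2.
Proof.
move=> m6 modd n4 nodd Ppart ncol nrow; have [_ Pthick] := Ppart.
have m3 : 3 < m by lia.
have n2 : 2 < n by lia.
rewrite ltnNge; apply/negP => Pge.
have Q2 S : S \in P -> 2 <= \sum_y (row_card S y)./2.
  by move=> SP; have [S0 Sth] := Pthick S SP; apply: two_half_rows; auto.
have rows_le : \sum_(S in P) \sum_y (row_card S y)./2 <= n * m./2.
  rewrite exchange_big -[n in n * _]card_ord -sum_nat_const.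
  by apply: leq_sum => y _; apply: sum_half_row_le.
have rows_ge : #|P|.*2 <= \sum_(S in P) \sum_y (row_card S y)./2.
  by rewrite -muln2 -sum_nat_const; apply: leq_sum.
(* [rows_le], [rows_ge] and [Pge] leave no slack, so no class can have a larger sum. *)
have Qeq S : S \in P -> \sum_y (row_card S y)./2 = 2.
  move=> SP; apply/eqP; rewrite eqn_leq Q2 // andbT leqNgt; apply/negP => Q3.
  suff : #|P|.*2 < \sum_(S in P) \sum_y (row_card S y)./2 by lia.
  rewrite -muln2 -sum_nat_const (bigD1 S) //= [X in _ < X](bigD1 S) //=.
  by rewrite -addSn leq_add // leq_sum // => T /andP[TP _]; apply: Q2.
(* Likewise every row attains [m./2]; as [m] is odd, a single odd count remains. *)
have odd1 y : \sum_(S in P) odd (row_card S y) = 1.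
  have := sum_half_row y Ppart; have := sum_half_row_le y Ppart.
  suff : m./2 <= \sum_(S in P) (row_card S y)./2 by lia.
  rewrite leqNgt; apply/negP => Qy.
  suff : \sum_(S in P) \sum_y (row_card S y)./2 < n * m./2 by lia.
  rewrite exchange_big -[n in n * _]card_ord -sum_nat_const (bigD1 y) //=.
  rewrite [X in _ < X](bigD1 y) //= -addSn leq_add // leq_sum // => z _.
  exact: sum_half_row_le.
have dich S : S \in P -> (exists i i', wide_rows S i i' /\ forall y, 0 < row_card S y)
    \/ forall x, ~~ odd (row_card (transp S) x).
  by move=> SP; have [S0 Sth] := Pthick S SP; apply: spread_or_even_columns; auto.
(* Column [x] has [n] cells, an odd number, so some class meets it oddly; by [dich] that class meets
   all rows. *)
have oddcol x : exists S, [/\ S \in P, odd (row_card (transp S) x)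
    & exists i i', wide_rows S i i' /\ forall y, 0 < row_card S y].
  have [/existsP[S /andP[SP So]]|/existsPn noodd] :=
      boolP [exists S, (S \in P) && odd (row_card (transp S) x)].
    exists S; split=> //; have [//|/(_ x)] := dich S SP; by rewrite So.
  have := sum_half_row x (torus_partition_transp Ppart).
  rewrite big_imset /=; last by move=> S T _ _; apply: transp_inj.
  rewrite big1; first by move=> nE; rewrite -nE add0n odd_double in nodd.
  by move=> S SP; have := noodd S; rewrite SP /= => /negbTE ->.
have m0 : 0 < m by lia.
have [S [SP _ [i [i' [wide Sall]]]]] := oddcol (Ordinal m0).
have uniqS T : T \in P -> (exists i i', wide_rows T i i' /\ forall y, 0 < row_card T y) ->
    T = S.
  move=> TP [k [k' [wideT Tall]]]; apply/eqP; apply: contraT => TS.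
  (* As [n > 4], some row avoids the four wide rows; both classes would meet it oddly, against
     [odd1]. *)
  have [y] : exists y, y \notin [:: i; i'; k; k'].
    apply/existsP; apply: contraLR n4; rewrite negb_exists => /forallP all4.
    rewrite -leqNgt -[n]card_ord; apply: leq_trans (card_size [:: i; i'; k; k']).
    by apply: subset_leq_card; apply/subsetP => y _; have := all4 y; rewrite negbK.
  rewrite !inE !negb_or => /and4P[yi yi' yk yk'].
  have := odd1 y; rewrite (bigD1 S) //= (bigD1 T) /= ?TP //.
  by rewrite (wide_rows_odd wide) // (wide_rows_odd wideT).
have [S0 Sth] := Pthick S SP.
(* [S] meets every column, hence meets it in a wide row; but two wide rows hold at most six
   cells. *)
suff : m <= row_card S i + row_card S i'.
  by have [_ /andP[_ ?] /andP[_ ?] _] := wide; lia.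
rewrite -{1}[m]card_ord /row_card -cardUI; apply: leq_trans (leq_addr _ _).
apply: subset_leq_card; apply/subsetP => x _; rewrite !inE.
have [T [TP Todd /(uniqS T TP) TS]] := oddcol x; subst T.
by apply: column_meets_wide_row wide _; auto; case: row_card Todd.
Qed.

(** * Case distinction and final values *)

(** Boolean quantifiers over finite types decide the alternative constructively. *)
Lemma full_column_or_none m n (P : {set {set 'I_m * 'I_n}}) :
  (exists2 S, S \in P & full_column S) \/ (forall S, S \in P -> ~ full_column S).
Proof.
have [/existsP[S /andP[SP /existsP[x /forallP xS]]]|/existsPn nfull] :=
    boolP [exists S in P, exists x, [forall y, (x, y) \in S]].
  by left; exists S => //; exists x.
right=> S SP [x xS]; have := nfull S; rewrite SP => /existsPn/(_ x)/forallPn[y].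
by rewrite xS.
Qed.

Lemma odd_even_bound m n (P : {set {set 'I_m * 'I_n}}) :
  3 < m -> odd m -> 3 < n -> ~~ odd n -> torus_partition P ->
  #|P| <= 1 + m./2 * n./2.
Proof.
move=> m3 modd n3 neven Ppart; have m2 : 2 < m by lia.
have n2 : 2 < n by lia.
have [[S SP Sfull]|ncol] := full_column_or_none P.
  have := full_column_bound m2 n3 Ppart SP Sfull.
  have -> : m.-1 = m./2.*2 by lia.
  by rewrite -doubleMl leq_double -subn1 leq_subLR.
have := no_full_column_bound m3 n2 Ppart ncol.
rewrite -[n in n * _]odd_double_half (negbTE neven) add0n -doubleMl leq_double.
by rewrite mulnC => /leqW.
Qed.

(* For odd [m = 2a + 1] and [n = 2b + 1] the sharp count only gives
   [2 #|P| < 2ab + a], which suffices exactly when [a <= 4]. *)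
Lemma odd_odd_bound m n (P : {set {set 'I_m * 'I_n}}) :
  6 < m < 11 -> odd m -> 4 < n -> odd n -> torus_partition P ->
  #|P| <= 1 + m./2 * n./2.
Proof.
move=> /andP[m6 m10] modd n4 nodd Ppart.
have [m3 m2 n3 n2] : [/\ 3 < m, 2 < m, 3 < n & 2 < n] by split; lia.
have [[S SP Sfull]|ncol] := full_column_or_none P.
  have := full_column_bound m2 n3 Ppart SP Sfull.
  have -> : m.-1 = m./2.*2 by lia.
  by rewrite -doubleMl leq_double -subn1 leq_subLR.
have Tpart := torus_partition_transp Ppart.
have [[T TP Tfull]|nrow] := full_column_or_none (@transp m n @: P).
  have := full_column_bound n2 m3 Tpart TP Tfull.
  rewrite card_imset; last exact: transp_inj.
  have -> : n.-1 = n./2.*2 by lia.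
  by rewrite -doubleMl leq_double mulnC -subn1 leq_subLR.
have nrow' S : S \in P -> ~ full_row S.
  move=> SP [y yS]; case: (nrow (transp S)); first exact: imset_f.
  by exists y => x; rewrite in_transp.
have := no_full_line_bound m6 modd n4 nodd Ppart ncol nrow'.
rewrite -[n in n * _]odd_double_half nodd mulnDl mul1n -doubleMl mulnC.
by move: (_ * _) => k; lia.
Qed.

Lemma majority_number_le m n k : 2 < m -> 2 < n ->
  (forall P : {set {set 'I_m * 'I_n}}, torus_partition P -> #|P| <= k) ->
  majority_number (cart_prod (cycle_graph m) (cycle_graph n)) <= k.
Proof.
move=> m2 n2 Pk; apply/bigmax_leqP => P /(majority_colouring_torus m2 n2).
exact: Pk.
Qed.

Lemma majority_number_le_transp m n k : 2 < m -> 2 < n ->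
  (forall P : {set {set 'I_m * 'I_n}}, torus_partition P -> #|P| <= k) ->
  majority_number (cart_prod (cycle_graph n) (cycle_graph m)) <= k.
Proof.
move=> m2 n2 Pk; apply: majority_number_le => // P /torus_partition_transp/Pk.
by rewrite card_imset //; apply: transp_inj.
Qed.

Lemma majority_number_odd m n : odd m -> 2 < m -> 2 < n ->
  (forall P : {set {set 'I_m * 'I_n}}, torus_partition P ->
     #|P| <= 1 + m./2 * n./2) ->
  majority_number (cart_prod (cycle_graph m) (cycle_graph n)) = 1 + m./2 * n./2
  /\ majority_number (cart_prod (cycle_graph n) (cycle_graph m)) = 1 + m./2 * n./2.
Proof.
move=> modd m2 n2 Pk; have [ge1 ge2] := block_colours_bound modd m2 n2.
split; apply/eqP; rewrite eqn_leq ?ge1 ?ge2 andbT.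
  exact: majority_number_le.
exact: majority_number_le_transp.
Qed.

Theorem theorem3 :
  [/\ forall m n : nat, 5 <= m -> odd m -> 4 <= n -> ~~ odd n ->
        majority_number (cart_prod (cycle_graph m) (cycle_graph n))
          = 1 + n./2 * m./2,
      forall m n : nat, 4 <= m -> ~~ odd m -> 5 <= n -> odd n ->
        majority_number (cart_prod (cycle_graph m) (cycle_graph n))
          = 1 + m./2 * n./2,
      forall n : nat, 7 <= n -> odd n ->
        majority_number (cart_prod (cycle_graph 7) (cycle_graph n))
          = 1 + 7./2 * n./2
    & forall m n : nat,
        (m, n) \in [:: (9, 9); (9, 11); (9, 13); (11, 9); (13, 9)] ->
        majority_number (cart_prod (cycle_graph m) (cycle_graph n))
          = 1 + m./2 * n./2].
Proof.
have thm_i m n : 5 <= m -> odd m -> 4 <= n -> ~~ odd n -> _ :=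
  fun m5 modd n4 neven => majority_number_odd modd (ltnW (ltnW m5)) (ltnW n4)
    (fun P => @odd_even_bound m n P (ltnW m5) modd n4 neven).
have thm_ii m n : 6 < m < 11 -> odd m -> 4 < n -> odd n -> _ :=
  fun m7 modd n4 nodd => majority_number_odd modd
    (leq_trans (isT : 2 < 7) (proj1 (andP m7))) (ltnW (ltnW n4))
    (fun P => @odd_odd_bound m n P m7 modd n4 nodd).
split=> [m n m5 modd n4 neven|m n m4 meven n5 nodd|n n7 nodd|m n].
- by rewrite mulnC; have [] := thm_i m n m5 modd n4 neven.
- by rewrite mulnC; have [] := thm_i n m n5 nodd m4 meven.
- by have [] := thm_ii 7 n isT isT (ltnW (ltnW n7)) nodd.
(* The pairs (11, 9) and (13, 9) come by transposition, since [thm_ii] requires [m < 11]. *)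
rewrite !inE => /or4P[|||/orP[]]; rewrite xpair_eqE => /andP[/eqP-> /eqP->].
- by have [] := thm_ii 9 9 isT isT isT isT.
- by have [] := thm_ii 9 11 isT isT isT isT.
- by have [] := thm_ii 9 13 isT isT isT isT.
- by rewrite mulnC; have [] := thm_ii 9 11 isT isT isT isT.
by rewrite mulnC; have [] := thm_ii 9 13 isT isT isT isT.
Qed.
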